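(* Let $n\ge4$ be even and let $a,b$ be positive integers. An $a\times b$ rectangle can be tiled by $\mathcal{T}_n$ if and only if $a$ and $b$ are both even and at least one of $a,b$ is divisible by $n$. Moreover, every tiling by $\mathcal{T}_n$ of the rectangle $[0,b]\times[0,a]$ follows the rectangular pattern.
   Context: A cell is a unit square $[i,i+1]\times[j,j+1]$ with $i,j\in\mathbb{Z}$; write $(i,j)$ for it. Define polyominoes (up to integer translation): $T_1=\{(0,j):0\le j\le n-2\}\cup\{(1,0)\}$; $T_2=\{(1,j):0\le j\le n-2\}\cup\{(0,n-2)\}$; $T_3=\{(i,0):0\le i\le n-2\}\cup\{(0,1)\}$; $T_4=\{(i,1):0\le i\le n-2\}\cup\{(n-2,0)\}$ (the ribbon $L$-shaped $n$-ominoes), and $\mathcal{T}_n=\{T_1,T_2,T_3,T_4\}$. A tiling of a region by a set of tiles is a covering of the region by integer translates (no rotations or reflections) of tiles from the set with pairwise disjoint interiors. An $a\times b$ rectangle has height $a$ and base $b$. A rectangle is even if all its vertex coordinates are even. A tiling by $\mathcal{T}_n$ follows the rectangular pattern on a region $P$ if $P$ is the union of non-overlapping even $2\times n$ and $n\times 2$ rectangles, each of which is exactly the union of two tiles of the tiling. *)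

(* Defs.v *)
From mathcomp Require Import all_boot all_order all_algebra.
From mathcomp Require Import boolp classical_sets.

Set Implicit Arguments.
Unset Strict Implicit.
Unset Printing Implicit Defensive.

Import Order.TTheory GRing.Theory Num.Theory.
Local Open Scope classical_set_scope.
Local Open Scope ring_scope.

(* The pair (i, j) stands for the unit square [i, i+1] x [j, j+1].  A region
   that is a union of cells is represented by its set of cells; two such
   regions have disjoint interiors iff their sets of cells are disjoint. *)
Definition cell : Type := (int * int)%type.

Definition translate (v : cell) (A : set cell) : set cell :=
  [set c + v | c in A].

Definition T1 (n : nat) : set cell :=
  [set c : cell | c.1 = 0 /\ 0 <= c.2 <= n%:Z - 2] `|` [set (1, 0)].
Definition T2 (n : nat) : set cell :=
  [set c : cell | c.1 = 1 /\ 0 <= c.2 <= n%:Z - 2] `|` [set (0, n%:Z - 2)].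
Definition T3 (n : nat) : set cell :=
  [set c : cell | c.2 = 0 /\ 0 <= c.1 <= n%:Z - 2] `|` [set (0, 1)].
Definition T4 (n : nat) : set cell :=
  [set c : cell | c.2 = 1 /\ 0 <= c.1 <= n%:Z - 2] `|` [set (n%:Z - 2, 0)].

Definition ribbon_L (n : nat) : set (set cell) := [set T1 n; T2 n; T3 n; T4 n].

(* [tau] is the set of placed tiles, each given by its set of cells. *)
Definition tiling (S : set (set cell)) (P : set cell) (tau : set (set cell)) :
    Prop :=
  [/\ forall t, tau t -> exists s v, S s /\ t = translate v s,
      trivIset tau id
    & \bigcup_(t in tau) t = P].

Definition tileable (S : set (set cell)) (P : set cell) : Prop :=
  exists tau, tiling S P tau.

(* The a x b rectangle (height a, base b) [x, x+b] x [y, y+a]. *)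
Definition rect (x y : int) (a b : nat) : set cell :=
  [set c : cell | x <= c.1 < x + b%:Z /\ y <= c.2 < y + a%:Z].

Definition even_rect (a b : nat) (R : set cell) : Prop :=
  exists x y : int,
    [/\ (2 %| x)%Z, (2 %| y)%Z, (2 %| x + b%:Z)%Z & (2 %| y + a%:Z)%Z] /\
    R = rect x y a b.

Definition rectangular_pattern (n : nat) (P : set cell)
    (tau : set (set cell)) : Prop :=
  exists rho : set (set cell),
    [/\ forall R, rho R -> even_rect 2 n R \/ even_rect n 2 R,
        trivIset rho id,
        \bigcup_(R in rho) R = P
      & forall R, rho R ->
          exists t1 t2, [/\ tau t1, tau t2, t1 <> t2 & t1 `|` t2 = R]].

(* Main.v *)
(* Call an even 2 x 2 square bad if it is not covered by an even 2 x n or n x 2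
   rectangle made of two tiles.  At a bad square which is minimal for the
   product order, everything to the left and below is occupied, so the tile at
   its lower left corner is one of four.  If it is a vertical tile leaning left
   (T2) or an unpartnered horizontal tile with its foot up (T3), then some bad
   cell lies strictly to the left.  The lowest such bad square, leftmost in its
   row, is again minimal and opens on a canal with a flat floor which is closed
   on the right, and this forces its corner tile to be T2 or T3 as well.  The
   descent to the left is impossible; the tiles T4 and T1 are symmetric under
   transposition, so there is no bad square.  The divisibility condition follows
   by weighting the cell (i, j) with z ^ (i + j) for a primitive n-th root of
   unity z. *)

Require Import Defs.
From mathcomp Require Import all_boot all_order all_algebra all_field.
From mathcomp Require Import boolp classical_sets.
From mathcomp Require Import zify.

Set Implicit Arguments.
Unset Strict Implicit.
Unset Printing Implicit Defensive.

Import Order.TTheory GRing.Theory Num.Theory.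
Local Open Scope classical_set_scope.
Local Open Scope ring_scope.

(** * Auxiliary facts about integers *)

Lemma int_half (z : int) : exists i : int, 2 * i <= z <= 2 * i + 1.
Proof. by exists (z %/ 2)%Z; lia. Qed.

Lemma int_least (P : int -> Prop) (z0 : int) :
  (forall z, P z -> 0 <= z) -> P z0 ->
  exists z, P z /\ forall z', P z' -> z <= z'.
Proof.
move=> P_ge0; have [N] : exists N : nat, z0 < N%:Z by exists `|z0|.+1%N; lia.
elim: N z0 => [|N IHN] z0 lt_z0N Pz0; first by have := P_ge0 _ Pz0; lia.
have [[z [Pz lt_zz0]]|no_less] := pselect (exists z, P z /\ z < z0).
  by apply: (IHN z) => //; lia.
exists z0; split=> // z Pz; rewrite leNgt; apply/negP => lt_zz0.
by apply: no_less; exists z.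
Qed.

(** * Tiles and placements in coordinates *)

Inductive kind := V1 | V2 | H3 | H4.

(** The anchor [(x, y)] is the lower left corner of the bounding box of the tile; for [n >= 4] it
    belongs to T1 and T3 but not to T2 and T4. *)
Definition covers (n : int) (k : kind) (x y cx cy : int) : Prop :=
  match k with
  | V1 => (cx = x /\ y <= cy <= y + n - 2) \/ (cx = x + 1 /\ cy = y)
  | V2 => (cx = x + 1 /\ y <= cy <= y + n - 2) \/ (cx = x /\ cy = y + n - 2)
  | H3 => (cy = y /\ x <= cx <= x + n - 2) \/ (cx = x /\ cy = y + 1)
  | H4 => (cy = y + 1 /\ x <= cx <= x + n - 2) \/ (cx = x + n - 2 /\ cy = y)
  end.

Section Placement.

Variables (n m a b : int) (T : kind -> int -> int -> Prop).
Hypotheses (n_ge4 : 4 <= n) (n_double : n = 2 * m).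

Local Notation M := (covers n).

Definition placement : Prop :=
  [/\ forall k x y cx cy, T k x y -> M k x y cx cy ->
        0 <= cx < b /\ 0 <= cy < a,
      forall cx cy, 0 <= cx < b -> 0 <= cy < a ->
        exists k x y, T k x y /\ M k x y cx cy
    & forall k x y k' x' y' cx cy, T k x y -> T k' x' y' ->
        M k x y cx cy -> M k' x' y' cx cy -> [/\ k = k', x = x' & y = y']].

(** A T1 interlocks with the T2 anchored one unit above it, a T3 with the T4 anchored one unit to
    its right. *)
Definition paired (cx cy : int) : Prop := exists i j : int,
  [/\ T V1 (2 * i) (2 * j), T V2 (2 * i) (2 * j + 1),
      2 * i <= cx <= 2 * i + 1 & 2 * j <= cy < 2 * j + n] \/
  [/\ T H3 (2 * i) (2 * j), T H4 (2 * i + 1) (2 * j),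
      2 * i <= cx < 2 * i + n & 2 * j <= cy <= 2 * j + 1].

Hypothesis T_placement : placement.

Let T_sub k x y cx cy :
  T k x y -> M k x y cx cy -> 0 <= cx < b /\ 0 <= cy < a.
Proof. by case: T_placement => + _ _; apply. Qed.

Let T_cov (cx cy : int) : 0 <= cx < b -> 0 <= cy < a ->
  exists k x y, T k x y /\ M k x y cx cy.
Proof. by case: T_placement => _ + _; apply. Qed.

Let T_disj k x y k' x' y' cx cy : T k x y -> T k' x' y' ->
  M k x y cx cy -> M k' x' y' cx cy -> [/\ k = k', x = x' & y = y'].
Proof. by case: T_placement => _ _; apply. Qed.

(** * Paired cells and bad squares *)

(** A paired rectangle has an even corner and, as [n] is even, even sides, so it is a union of even
    2 x 2 squares. *)
Lemma paired_square i j cx cy cx' cy' :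
  2 * i <= cx <= 2 * i + 1 -> 2 * j <= cy <= 2 * j + 1 ->
  2 * i <= cx' <= 2 * i + 1 -> 2 * j <= cy' <= 2 * j + 1 ->
  paired cx cy -> paired cx' cy'.
Proof.
move=> hx hy hx' hy' [p [q [[t1 t2 h1 h2]|[t1 t2 h1 h2]]]]; exists p, q.
  by left; split=> //; lia.
by right; split=> //; lia.
Qed.

(** By disjointness, a tile that meets a paired rectangle is one of its two halves. *)
Lemma paired_tile k x y cx cy cx' cy' :
  T k x y -> M k x y cx cy -> M k x y cx' cy' -> paired cx cy ->
  paired cx' cy'.
Proof.
move=> tk hc hc' [i [j [[t1 t2 h1 h2]|[t1 t2 h1 h2]]]].
  have [h|h] : M V1 (2 * i) (2 * j) cx cy \/ M V2 (2 * i) (2 * j + 1) cx cy.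
    by rewrite /=; lia.
  - have [? ? ?] := T_disj tk t1 hc h; subst k x y.
    by exists i, j; left; move: hc' => /= hc'; split=> //; lia.
  - have [? ? ?] := T_disj tk t2 hc h; subst k x y.
    by exists i, j; left; move: hc' => /= hc'; split=> //; lia.
have [h|h] : M H3 (2 * i) (2 * j) cx cy \/ M H4 (2 * i + 1) (2 * j) cx cy.
  by rewrite /=; lia.
- have [? ? ?] := T_disj tk t1 hc h; subst k x y.
  by exists i, j; right; move: hc' => /= hc'; split=> //; lia.
- have [? ? ?] := T_disj tk t2 hc h; subst k x y.
  by exists i, j; right; move: hc' => /= hc'; split=> //; lia.
Qed.

(* [bad i j] is about the square with lower left cell [(2 * i, 2 * j)].  It may
   stick out of the region when [a] or [b] is odd, but that cell lies inside. *)
Definition bad (i j : int) : Prop :=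
  [/\ 0 <= 2 * i < b, 0 <= 2 * j < a & ~ paired (2 * i) (2 * j)].

(** Badness spreads along a tile; this is how bad squares to the left or below are produced. *)
Lemma bad_tile k x y cx cy cx' cy' i j :
  T k x y -> M k x y cx cy -> ~ paired cx cy -> M k x y cx' cy' ->
  2 * i <= cx' <= 2 * i + 1 -> 2 * j <= cy' <= 2 * j + 1 -> bad i j.
Proof.
move=> tk hc npc hc' hi hj; have [hx hy] := T_sub tk hc'.
split; [lia|lia|move=> pij; apply: npc].
apply: (paired_tile tk hc' hc).
by apply: (@paired_square i j) pij => //; lia.
Qed.

Definition min_bad (i j : int) : Prop :=
  bad i j /\ forall i' j', bad i' j' -> i' <= i -> j' <= j -> i' = i /\ j' = j.

Lemma bad_min i j : bad i j -> exists i' j', min_bad i' j'.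
Proof.
move=> bij.
have [//||s [[i' [j' [b' eq_s]]] min_s]] := @int_least
  (fun s => exists i' j', bad i' j' /\ s = i' + j') (i + j).
- by move=> s [i' [j' [[]]]]; lia.
- by exists i, j.
exists i', j'; split=> // p q bpq; have := min_s (p + q).
have: exists i' j', bad i' j' /\ p + q = i' + j' by exists p, q.
by move=> h /(_ h); lia.
Qed.

(** [(u, v)] is minimal because every square weakly to its left is also left of column [i]. It lies
    above row [j], since otherwise it would contradict the minimality of [(i, j)]. The last clause
    is the floor of the canal. *)
Lemma min_bad_left i j i' j' : min_bad i j -> bad i' j' -> i' < i ->
  exists u v, [/\ min_bad u v, u < i, j < v <= j'
    & forall p q, bad p q -> p < i -> v <= q].
Proof.
move=> [bij minij] b' lt_i'i.
have [||v [[u0 [bu0 lt_u0]] min_v]] := @int_least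
  (fun v => exists u, bad u v /\ u < i) j'.
- by move=> v [u [[]]]; lia.
- by exists i'.
have [||u [[bu lt_u] min_u]] := @int_least
  (fun u => bad u v /\ u < i) u0 => //.
- by move=> u [[]]; lia.
have vle : v <= j' by apply: min_v; exists i'.
exists u, v; split=> //.
- split=> // p q bpq hp hq.
  have : v <= q by apply: min_v; exists p; split=> //; lia.
  move=> hvq; have eq_qv : q = v by lia.
  by subst q; have : u <= p; [apply: min_u; split=> //; lia | lia].
- suff : ~ (v <= j) by lia.
  by move=> hv; have := minij _ _ bu; lia.
- by move=> p q bpq hp; apply: min_v; exists p.
Qed.

(** * The tile at the corner of a minimal bad square *)

(** Every other cell of a tile has one of these four neighbours in the tile. The diagonal ones are
    there for the feet of T2 and T4, which have no left or lower neighbour in their tile. *)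
Lemma covers_base k x y cx cy : M k x y cx cy ->
  ~ M k x y (cx - 1) cy -> ~ M k x y cx (cy - 1) ->
  ~ M k x y (cx - 1) (cy + 1) -> ~ M k x y (cx + 1) (cy - 1) ->
  [\/ [/\ k = V1, x = cx & y = cy], [/\ k = V2, x = cx - 1 & y = cy],
      [/\ k = H3, x = cx & y = cy] | [/\ k = H4, x = cx & y = cy - 1]].
Proof.
by case: k => /= h1 h2 h3 h4 h5;
  [constructor 1|constructor 2|constructor 3|constructor 4]; split=> //; lia.
Qed.

(** The neighbours in [covers_base] lie in the squares just left and just below, where the unpaired
    corner tile would create a smaller bad square. *)
Lemma min_bad_corner u v : min_bad u v ->
  [\/ T V1 (2 * u) (2 * v), T V2 (2 * u - 1) (2 * v),
      T H3 (2 * u) (2 * v) | T H4 (2 * u) (2 * v - 1)].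
Proof.
move=> [[hu hv np] min_uv].
have [k [x [y [tk hc]]]] := T_cov hu hv.
have low (cx cy i j : int) : M k x y cx cy ->
    i <= u -> j <= v -> i + j < u + v ->
    2 * i <= cx <= 2 * i + 1 -> 2 * j <= cy <= 2 * j + 1 -> False.
  by move=> hc' ? ? ? ? ?; have := min_uv i j (bad_tile tk hc np hc' _ _); lia.
have [||||[? ? ?]|[? ? ?]|[? ? ?]|[? ? ?]] := covers_base hc.
- by move=> c; have := @low _ _ (u - 1) v c; lia.
- by move=> c; have := @low _ _ u (v - 1) c; lia.
- by move=> c; have := @low _ _ (u - 1) v c; lia.
- by move=> c; have := @low _ _ u (v - 1) c; lia.
- by constructor 1; subst.
- by constructor 2; subst.
- by constructor 3; subst.
- by constructor 4; subst.
Qed.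

(* The canal is the part of row [2 * v] between the corner of the bad square
   [(u, v)] and the wall tile [k] at abscissa [w].  The floor keeps T4 out; T1
   is excluded because its foot would be at the bottom of a pit which only the
   partner of T1 can fill.  A wall of height one is harmless at odd [w], as it
   is then not adjacent to the foot. *)
Lemma min_bad_canal i u v w k x y :
  min_bad u v -> (forall p q, bad p q -> p < i -> v <= q) ->
  2 * u < w <= 2 * i -> T k x y -> M k x y w (2 * v) ->
  (forall z, 2 * u <= z < w -> ~ M k x y z (2 * v)) ->
  (exists e, w = 2 * e + 1) \/
  (M k x y w (2 * v + 1) /\
   (~ M k x y (w - 1) (2 * v + 1) \/ M k x y (w - 2) (2 * v + 1))) ->
  T V2 (2 * u - 1) (2 * v) \/ T H3 (2 * u) (2 * v).
Proof.
move=> muv floor hw tw hcw wall hgt.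
have [[hu hv np] min_uv] := muv.
(* The row of such a T4 either reaches [w], so that the wall tile is this T4 and enters the canal,
   or ends before [w], and then its foot hangs below the floor. *)
have noH4 (z : int) : 2 * u <= z < w -> T H4 z (2 * v - 1) ->
    ~ paired z (2 * v) -> False.
  move=> hz t4 npz.
  have [le_w|lt_w] := leP w (z + n - 2).
    have c4 : M H4 z (2 * v - 1) w (2 * v) by rewrite /=; lia.
    have [ek ex ey] := T_disj tw t4 hcw c4; subst k x y.
    by apply: (wall z) => //=; lia.
  have [p hp] := int_half (z + n - 2).
  have := floor p (v - 1).
  have : bad p (v - 1).
    apply: (bad_tile t4 (cx := z) (cy := 2 * v) (cx' := z + n - 2)
      (cy' := 2 * v - 1)) => //=; lia.
  by move=> bp /(_ bp); lia.
have [t1|t2|t3|t4] := min_bad_corner muv; [|by left|by right|].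
2: by case: (@noH4 (2 * u)) => //; lia.
have w_gt : 2 * u + 1 < w.
  suff: ~ (w = 2 * u + 1) by lia.
  move=> ew; have c1 : M V1 (2 * u) (2 * v) w (2 * v) by rewrite /=; lia.
  have [ek ex ey] := T_disj tw t1 hcw c1; subst k x y.
  by apply: (wall (2 * u)) => //=; lia.
have [wx wy] := T_sub tw hcw.
(* The cell to the right of the foot's top neighbour is occupied by a tile
   which does not reach over the foot. *)
have [k2 [x2 [y2 [t2 c2 nc2]]]] : exists k2 x2 y2,
    [/\ T k2 x2 y2, M k2 x2 y2 (2 * u + 2) (2 * v + 1)
      & ~ M k2 x2 y2 (2 * u + 1) (2 * v + 1)].
  (* A wall adjacent to the foot is itself the required tile: [w] is even, so the height condition
     applies, and a wall tile reaching [w - 2] would meet the shaft of the T1. *)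
  have [ew|nw] := eqVneq w (2 * u + 2).
    case: hgt => [[e]|[c2 nc2]]; first lia.
    exists k, x, y; split=> //; first by rewrite -ew.
    move=> c3; case: nc2; first by apply; have -> : w - 1 = 2 * u + 1 by lia.
    have -> : w - 2 = 2 * u by lia.
    move=> c4.
    have c1 : M V1 (2 * u) (2 * v) (2 * u) (2 * v + 1) by rewrite /=; lia.
    have [ek ex ey] := T_disj tw t1 c4 c1; subst k x y.
    by apply: (wall (2 * u)) => //=; lia.
  have rx : 0 <= 2 * u + 2 < b by lia.
  have [pz|npz] := pselect (paired (2 * u + 2) (2 * v)).
    have pz' : paired (2 * u + 2) (2 * v + 1).
      by apply: (@paired_square (u + 1) v) pz; lia.
    have ry : 0 <= 2 * v + 1 < a.
      have c1 : M V1 (2 * u) (2 * v) (2 * u) (2 * v + 1) by rewrite /=; lia.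
      by have [] := T_sub t1 c1.
    have [k2 [x2 [y2 [t2 c2]]]] := T_cov rx ry.
    exists k2, x2, y2; split=> // c3; apply: np.
    have pz2 := paired_tile t2 c2 c3 pz'.
    by apply: (@paired_square u v) pz2; lia.
  (* This tile has its base here. T4 is kept out by [noH4]; T1, T2 and T3 all cover the cell above
     the base cell, but not the one to the left of that. *)
  have [k2 [x2 [y2 [t2 c2]]]] := T_cov rx hv.
  have lowz (z : int) : 2 * u <= z < w -> ~ M k2 x2 y2 z (2 * v - 1).
    move=> hz hc; have [p hp] := int_half z.
    have bp : bad p (v - 1) by apply: (bad_tile t2 c2 npz hc hp); lia.
    by have := floor _ _ bp; lia.
  have nleft : ~ M k2 x2 y2 (2 * u + 2 - 1) (2 * v).
    have -> : 2 * u + 2 - 1 = 2 * u + 1 by lia.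
    have c1 : M V1 (2 * u) (2 * v) (2 * u + 1) (2 * v) by rewrite /=; lia.
    move=> c3; have [? ? ?] := T_disj t2 t1 c3 c1; subst.
    by move: c2 => /=; lia.
  have nlow : ~ M k2 x2 y2 (2 * u + 2) (2 * v - 1) by apply: lowz; lia.
  have [||[ek ? ?]|[ek ? ?]|[ek ? ?]|[ek ? ?]] := covers_base c2 nleft nlow.
  - move=> c3; have c4 : M k2 x2 y2 (2 * u) (2 * v + 1).
      by move: c2 nleft nlow c3; case: (k2) => /=; lia.
    have c1 : M V1 (2 * u) (2 * v) (2 * u) (2 * v + 1) by rewrite /=; lia.
    have [? ? ?] := T_disj t2 t1 c4 c1; subst k2 x2 y2.
    by move: c2 => /=; lia.
  - have [lt_w|ge_w] := ltP (2 * u + 3) w.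
      have -> : 2 * u + 2 + 1 = 2 * u + 3 by lia.
      by apply: lowz; lia.
    have ew : w = 2 * u + 3 by lia.
    move=> c3; have c4 : M k2 x2 y2 w (2 * v).
      by move: c2 nleft nlow c3; case: (k2) => /=; lia.
    have [? ? ?] := T_disj tw t2 hcw c4; subst k2 x2 y2.
    by apply: (wall (2 * u + 2)) => //; lia.
  - by exists k2, x2, y2; subst k2; split=> //=; lia.
  - by exists k2, x2, y2; subst k2; split=> //=; lia.
  - by exists k2, x2, y2; subst k2; split=> //=; lia.
  - subst k2 x2 y2; case: (@noH4 (2 * u + 2)) => //; lia.
(* The pit above the foot is closed on the left, below and on the right, and its upper left
   neighbour is in the T1 too. Only the partner T2 fits in. *)
exfalso; apply: np.
have rx : 0 <= 2 * u + 1 < b by lia.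
have [_ ry] := T_sub t2 c2.
have [k3 [x3 [y3 [t3 c3]]]] := T_cov rx ry.
have notV1 z z' : M V1 (2 * u) (2 * v) z z' -> ~ M k3 x3 y3 z z'.
  move=> c1 c4; have [? ? ?] := T_disj t3 t1 c4 c1; subst k3 x3 y3.
  by move: c3 => /=; lia.
have nright : ~ M k3 x3 y3 (2 * u + 2) (2 * v + 1).
  move=> c4; have [? ? ?] := T_disj t3 t2 c4 c2; subst k3 x3 y3.
  exact: nc2.
have n1 : ~ M k3 x3 y3 (2 * u) (2 * v + 1) by apply: notV1 => /=; lia.
have n2 : ~ M k3 x3 y3 (2 * u + 1) (2 * v) by apply: notV1 => /=; lia.
have n3 : ~ M k3 x3 y3 (2 * u) (2 * v + 2) by apply: notV1 => /=; lia.
have [ek ex ey] : [/\ k3 = V2, x3 = 2 * u & y3 = 2 * v + 1].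
  by move: c3 nright n1 n2 n3; case: (k3) => /= *; split=> //; lia.
by subst k3 x3 y3; exists u, v; left; split=> //; lia.
Qed.

(** The wall is the shaft of the T2, except in the row of its foot, where it starts at the odd
    abscissa [2 * i - 1]. In the other rows parity keeps the foot out of row [2 * v + 1]. *)
Lemma min_bad_canal_V2 i u v y0 :
  min_bad u v -> (forall p q, bad p q -> p < i -> v <= q) -> u < i ->
  T V2 (2 * i - 1) (2 * y0) -> y0 <= v -> 2 * v <= 2 * y0 + n - 2 ->
  T V2 (2 * u - 1) (2 * v) \/ T H3 (2 * u) (2 * v).
Proof.
move=> muv floor lt_ui t2 le_y0 le_v.
have [ev|nv] := eqVneq (2 * v) (2 * y0 + n - 2).
  apply: (min_bad_canal (w := 2 * i - 1) muv floor _ t2) => /=; try lia.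
  by left; exists (i - 1); lia.
by apply: (min_bad_canal (w := 2 * i) muv floor _ t2) => /=; lia.
Qed.

(** * The descent to the left *)

(** A tile that reaches into column [2 * i - 1] provides a bad square there and then acts as the
    wall of the canal. For a T2 it is the corner tile itself; for a T3 it is the tile on top of its
    foot, at [(2 * i, 2 * j + 2)]. *)
Lemma min_bad_descent i j :
  min_bad i j -> T V2 (2 * i - 1) (2 * j) \/ T H3 (2 * i) (2 * j) ->
  exists u v, [/\ u < i, min_bad u v
    & T V2 (2 * u - 1) (2 * v) \/ T H3 (2 * u) (2 * v)].
Proof.
move=> mij; have [[hi hj np] min_ij] := mij => -[t2|t3].
  have b' : bad (i - 1) (j + m - 1).
    apply: (bad_tile t2 (cx := 2 * i) (cy := 2 * j) (cx' := 2 * i - 1)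
      (cy' := 2 * j + n - 2)) => //=; lia.
  have [|u [v [muv lt_ui hv floor]]] := min_bad_left mij b'; first lia.
  exists u, v; split=> //.
  by apply: (min_bad_canal_V2 muv floor _ t2); lia.
have sub3 z z' : M H3 (2 * i) (2 * j) z z' -> 0 <= z < b /\ 0 <= z' < a.
  exact: T_sub.
have [rx _] : 0 <= 2 * i + 1 < b /\ 0 <= 2 * j < a by apply: sub3 => /=; lia.
have [_ ry] : 0 <= 2 * i < b /\ 0 <= 2 * j + 1 < a by apply: sub3 => /=; lia.
have [k1 [x1 [y1 [t1 c1]]]] := T_cov rx ry.
have np1 : ~ paired (2 * i + 1) (2 * j + 1).
  by move=> p1; apply: np; apply: (@paired_square i j) p1; lia.
have notH3 k x y z z' : T k x y -> M k x y z z' ->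
    ~ M H3 (2 * i) (2 * j) z z' ->
    forall w w', M H3 (2 * i) (2 * j) w w' -> ~ M k x y w w'.
  move=> tk ck nc w w' c3 ck'.
  by have [? ? ?] := T_disj tk t3 ck' c3; subst k x y.
have notH3' : forall z z', M H3 (2 * i) (2 * j) z z' -> ~ M k1 x1 y1 z z'.
  by apply: (notH3 _ _ _ _ _ t1 c1) => /=; lia.
have n1 : ~ M k1 x1 y1 (2 * i) (2 * j + 1) by apply: notH3' => /=; lia.
have n2 : ~ M k1 x1 y1 (2 * i + 1) (2 * j) by apply: notH3' => /=; lia.
have n3 : ~ M k1 x1 y1 (2 * i + 2) (2 * j) by apply: notH3' => /=; lia.
have notH4 : ~ [/\ k1 = H4, x1 = 2 * i + 1 & y1 = 2 * j].
  move=> [? ? ?]; subst k1 x1 y1; apply: np; exists i, j; right.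
  by split=> //; lia.
(* The slot to the right of the foot of the T3 does not hold the partner T4. So either a T4 dips its
   foot into it, or the tile there rises to the next row without covering the top of the foot. *)
have [[ek ex ey]|[nH4 c2 nc2]] : [/\ k1 = H4, x1 = 2 * i + 3 - n
    & y1 = 2 * j + 1] \/
    [/\ k1 <> H4, M k1 x1 y1 (2 * i + 1) (2 * j + 2)
      & ~ M k1 x1 y1 (2 * i) (2 * j + 2)].
- move: c1 n1 n2 n3 notH4 => {np1 t1 notH3'}; case: k1 => /= c1 n1 n2 n3 notH4.
  + by right; split=> //; lia.
  + by right; split=> //; lia.
  + by right; split=> //; lia.
  + left; have [ex ey] : x1 = 2 * i + 3 - n /\ y1 = 2 * j + 1; last by split.
    have [//|nn] := pselect (x1 = 2 * i + 3 - n /\ y1 = 2 * j + 1).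
    by case: notH4; split=> //; lia.
- subst k1 x1 y1.
  have b' : bad (i - 1) (j + 1).
    apply: (bad_tile t1 c1 np1 (cx' := 2 * i - 1) (cy' := 2 * j + 2)) => //=;
      lia.
  have [|u [v [muv lt_ui hv floor]]] := min_bad_left mij b'; first lia.
  exists u, v; split=> //; have ev : v = j + 1 by lia.
  (* If the corner of [(u, v)] lies in this T4, there is no canal; then T1 is of the wrong kind, and
     a T4 based at the corner would have an even anchor abscissa. *)
  have [lt_uw|ge_uw] := ltP (2 * u) (2 * i + 3 - n).
    apply: (min_bad_canal (w := 2 * i + 3 - n) muv floor _ t1) => /=; try lia.
    by left; exists (i + 1 - m); lia.
  have c2 : M H4 (2 * i + 3 - n) (2 * j + 1) (2 * u) (2 * v) by rewrite /=; lia.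
  have [tc|tc|tc|tc] := min_bad_corner muv; [|by left|by right|].
    have c3 : M V1 (2 * u) (2 * v) (2 * u) (2 * v) by rewrite /=; lia.
    by have [] := T_disj t1 tc c2 c3.
  have c3 : M H4 (2 * u) (2 * v - 1) (2 * u) (2 * v) by rewrite /=; lia.
  by have [] := T_disj t1 tc c2 c3; lia.
have [_ ry2] := T_sub t1 c2.
have [t [x [y [tt ct]]]] := T_cov hi ry2.
have npt : ~ paired (2 * i) (2 * j + 2).
  move=> pt; apply: np1; apply: (paired_tile t1 c2 c1).
  by apply: (@paired_square i (j + 1)) pt; lia.
have m1 : ~ M t x y (2 * i + 1) (2 * j + 2).
  by move=> c3; have [? ? ?] := T_disj tt t1 c3 c2; subst t x y.
have m2 : ~ M t x y (2 * i) (2 * j + 1).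
  by apply: (notH3 _ _ _ _ _ tt ct) => /=; lia.
(* [t] rests on the foot of the T3 and is blocked on the right, which leaves one position for each
   kind. *)
case: t tt ct m1 m2 => /= tt ct m1 m2.
- have [? ?] : x = 2 * i - 1 /\ y = 2 * j + 2 by lia.
  subst x y.
  have b' : bad (i - 1) (j + 1).
    apply: (bad_tile tt ct npt (cx' := 2 * i - 1) (cy' := 2 * j + 2)) => //=;
      lia.
  have [|u [v [muv lt_ui hv floor]]] := min_bad_left mij b'; first lia.
  exists u, v; split=> //.
  by apply: (min_bad_canal (w := 2 * i - 1) muv floor _ tt) => /=; lia.
- have [? ?] : x = 2 * i - 1 /\ y = 2 * (j + 1) by lia.
  subst x y.
  have b' : bad (i - 1) (j + m).
    apply: (bad_tile tt ct npt (cx' := 2 * i - 1) (cy' := 2 * j + n)) => //=;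
      lia.
  have [|u [v [muv lt_ui hv floor]]] := min_bad_left mij b'; first lia.
  exists u, v; split=> //.
  by apply: (min_bad_canal_V2 muv floor _ tt); lia.
- have [? ?] : x = 2 * i + 2 - n /\ y = 2 * j + 2 by lia.
  subst x y.
  have b' : bad (i - 1) (j + 1).
    apply: (bad_tile tt ct npt (cx' := 2 * i - 1) (cy' := 2 * j + 2)) => //=;
      lia.
  have [|u [v [muv lt_ui hv floor]]] := min_bad_left mij b'; first lia.
  exists u, v; split=> //; have ev : v = j + 1 by lia.
  have [lt_uw|ge_uw] := ltP (2 * u) (2 * i + 2 - n).
    by apply: (min_bad_canal (w := 2 * i + 2 - n) muv floor _ tt) => /=; lia.
  have c3 : M H3 (2 * i + 2 - n) (2 * j + 2) (2 * u) (2 * v) by rewrite /=; lia.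
  have [tc|tc|tc|tc] := min_bad_corner muv; [|by left|by right|].
    have c4 : M V1 (2 * u) (2 * v) (2 * u) (2 * v) by rewrite /=; lia.
    by have [] := T_disj tt tc c3 c4.
  have c4 : M H4 (2 * u) (2 * v - 1) (2 * u) (2 * v) by rewrite /=; lia.
  by have [] := T_disj tt tc c3 c4.
- have [? ?] : x = 2 * i + 2 - n /\ y = 2 * j + 2 by lia.
  subst x y.
  have b' : bad (i - 1) (j + 1).
    apply: (bad_tile tt ct npt (cx' := 2 * i - 1) (cy' := 2 * j + 3)) => //=;
      lia.
  have [|u [v [muv lt_ui hv floor]]] := min_bad_left mij b'; first lia.
  exists u, v; split=> //.
  (* The wall is the foot of a T4 whose row passes over the canal; this is the case for the
     alternative [w - 2]. *)
  by apply: (min_bad_canal (w := 2 * i) muv floor _ tt) => /=; lia.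
Qed.

(** Infinite descent on [i], which is nonnegative for a bad square. *)
Lemma min_bad_not_leftward i j :
  min_bad i j -> ~ (T V2 (2 * i - 1) (2 * j) \/ T H3 (2 * i) (2 * j)).
Proof.
have [N] : exists N : nat, i < N%:Z by exists `|i|.+1%N; lia.
elim: N i j => [|N IHN] i j ltN mij tij.
  by have [[]] := mij; lia.
have [u [v [lt_ui muv tuv]]] := min_bad_descent mij tij.
by apply: (IHN u v) => //; lia.
Qed.

End Placement.

(** * Reflection in the diagonal *)

Definition flip (k : kind) : kind :=
  match k with V1 => H3 | V2 => H4 | H3 => V1 | H4 => V2 end.

Lemma covers_flip n k x y cx cy :
  covers n (flip k) y x cy cx <-> covers n k x y cx cy.
Proof. by case: k => /=; lia. Qed.

Section Transpose.

Variables (n m a b : int) (T : kind -> int -> int -> Prop).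

Definition transpose (k : kind) (x y : int) : Prop := T (flip k) y x.

Lemma placement_transpose : placement n a b T -> placement n b a transpose.
Proof.
move=> [sub cov disj]; split.
- move=> k x y cx cy tk /covers_flip ck.
  by have [] := sub _ _ _ _ _ tk ck.
- move=> cx cy hx hy; have [k [x [y [tk ck]]]] := cov _ _ hy hx.
  exists (flip k), y, x; split; last by apply/covers_flip; case: (k) ck.
  by rewrite /transpose; case: (k) tk.
- move=> k x y k' x' y' cx cy tk tk' /covers_flip ck /covers_flip ck'.
  have [ek -> ->] := disj _ _ _ _ _ _ _ _ tk tk' ck ck'; split=> //.
  by case: k k' ek {tk tk' ck ck'} => [] [].
Qed.

Lemma paired_transpose cx cy : paired n transpose cy cx <-> paired n T cx cy.
Proof.
by split=> -[i [j [[t1 t2 h1 h2]|[t1 t2 h1 h2]]]]; exists j, i;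
  [right|left|right|left].
Qed.

Lemma min_bad_transpose i j :
  min_bad n a b T i j -> min_bad n b a transpose j i.
Proof.
move=> [[hi hj np] minij]; split.
  by split=> // /paired_transpose.
move=> p q [hp hq npq] lp lq.
suff : bad n a b T q p by move=> /minij h; have := h lq lp; lia.
by split=> // /paired_transpose.
Qed.

Hypotheses (n_ge4 : 4 <= n) (n_double : n = 2 * m).

Lemma placement_paired : placement n a b T ->
  forall cx cy, 0 <= cx < b -> 0 <= cy < a -> paired n T cx cy.
Proof.
move=> plT cx cy hx hy.
have [//|np] := pselect (paired n T cx cy).
have [k [x [y [tk ck]]]] : exists k x y, T k x y /\ covers n k x y cx cy.
  by case: plT => _ + _; apply.
have [p hp] := int_half cx; have [q hq] := int_half cy.
have bad_pq := bad_tile n_ge4 n_double plT tk ck np ck hp hq.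
have [i [j mij]] := bad_min n_ge4 n_double bad_pq.
have nl := min_bad_not_leftward n_ge4 n_double plT mij.
have plT' := placement_transpose plT.
have nd := min_bad_not_leftward n_ge4 n_double plT' (min_bad_transpose mij).
by case: (min_bad_corner n_ge4 n_double plT mij) => t;
  [case: nd; right|case: nl; left|case: nl; right|case: nd; left].
Qed.

End Transpose.

(** * Sets of cells versus placements *)

Definition shape (n : nat) (k : kind) : set cell :=
  match k with V1 => T1 n | V2 => T2 n | H3 => T3 n | H4 => T4 n end.

Definition tile (n : nat) (k : kind) (x y : int) : set cell :=
  translate (x, y) (shape n k).

Lemma tileP n k x y (c : cell) : tile n k x y c <-> covers n k x y c.1 c.2.
Proof.
case: c => cx cy /=; split.
  by case: k => -[[p q]] [/= [hp hq]|/= [hp hq]] [<- <-]; rewrite /covers; lia.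
move=> h; exists (cx - x, cy - y); last by congr pair; rewrite /= subrK.
case: k h => -[[h1 h2]|[h1 h2]].
all: by [left=> /=; lia | right; congr pair; lia].
Qed.

(** Disjointness in a tiling only identifies tiles as sets; this recovers kind and anchor. The
    anchor consists of the least coordinates of the cells. *)
Lemma covers_inj (n : int) k x y k' x' y' : 4 <= n ->
  (forall cx cy, covers n k x y cx cy <-> covers n k' x' y' cx cy) ->
  [/\ k = k', x = x' & y = y'].
Proof.
move=> n_ge4 eqM.
have least p u v cx cy : covers n p u v cx cy -> u <= cx /\ v <= cy.
  by case: p => /=; lia.
have attained p u v : exists cx cy, covers n p u v u cy /\ covers n p u v cx v.
  case: p => /=.
  - by exists u, v; lia.
  - by exists (u + 1), (v + n - 2); lia.
  - by exists u, v; lia.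
  - by exists (u + n - 2), (v + 1); lia.
have [cx [cy [/eqM/least hx /eqM/least hy]]] := attained k x y.
have [cx' [cy' [/eqM/least hx' /eqM/least hy']]] := attained k' x' y'.
have ex : x = x' by lia.
have ey : y = y' by lia.
subst x' y'; split=> //.
(* These three probe cells tell the four kinds apart. *)
have := eqM x y; have := eqM (x + 1) y; have := eqM x (y + 2).
by case: k k' {eqM hx hy hx' hy'} => [] [] //=; lia.
Qed.

Lemma ribbon_L_shape n s : ribbon_L n s <-> exists k, s = shape n k.
Proof.
split=> [[[[->|->]|->]|->]|[k ->]].
- by exists V1.
- by exists V2.
- by exists H3.
- by exists H4.
by case: k; rewrite /ribbon_L /=; tauto.
Qed.

Lemma rect0P a b (c : cell) :
  rect 0 0 a b c <-> 0 <= c.1 < b%:Z /\ 0 <= c.2 < a%:Z.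
Proof. by rewrite /rect /= !add0r. Qed.

Lemma tiling_placement n a b tau : (4 <= n)%N ->
  tiling (ribbon_L n) (rect 0 0 a b) tau ->
  placement n a b (fun k x y => tau (tile n k x y)).
Proof.
move=> n_ge4 [tau_ribbon tau_triv tau_cover]; split.
- move=> k x y cx cy tk ck.
  suff /rect0P : rect 0 0 a b (cx, cy) by [].
  by rewrite -tau_cover; exists (tile n k x y) => //; apply/tileP.
- move=> cx cy hx hy.
  have : rect 0 0 a b (cx, cy) by apply/rect0P.
  rewrite -tau_cover => -[t tau_t].
  have [s [[x y] [/ribbon_L_shape [k ->] et]]] := tau_ribbon t tau_t.
  move: tau_t; rewrite et => tau_t /tileP ct.
  by exists k, x, y.
- move=> k x y k' x' y' cx cy tk tk' ck ck'.
  have et : tile n k x y = tile n k' x' y'.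
    by apply: (tau_triv _ _ tk tk'); exists (cx, cy); split; apply/tileP.
  apply: (@covers_inj n) => // u v.
  by rewrite -(tileP n k x y (u, v)) -(tileP n k' x' y' (u, v)) et.
Qed.

Lemma placement_tileable (n a b : nat) T :
  placement n a b T -> tileable (ribbon_L n) (rect 0 0 a b).
Proof.
move=> [sub cov disj].
exists [set t | exists k x y, T k x y /\ t = tile n k x y]; split.
- move=> _ [k [x [y [_ ->]]]]; exists (shape n k), (x, y); split=> //.
  by apply/ribbon_L_shape; exists k.
- move=> _ _ [k [x [y [tk ->]]]] [k' [x' [y' [tk' ->]]]].
  move=> [c [/tileP ck /tileP ck']].
  by have [-> -> ->] := disj _ _ _ _ _ _ _ _ tk tk' ck ck'.
- apply/seteqP; split=> [c [_ [k [x [y [tk ->]]]] /tileP ck]|c /rect0P [hx hy]].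
    by apply/rect0P; apply: sub tk ck.
  have [k [x [y [tk ck]]]] := cov _ _ hx hy.
  by exists (tile n k x y); [exists k, x, y | apply/tileP].
Qed.

(** * Tilings of the admissible rectangles *)

Lemma translate_translate u v (A : set cell) :
  translate u (translate v A) = translate (v + u) A.
Proof.
apply/seteqP; split=> [_ [_ [c Ac <-] <-]|_ [c Ac <-]].
  by exists c => //; rewrite addrA.
by exists (c + v); [exists c | rewrite addrA].
Qed.

Lemma translate_rect (x y u v : int) a b :
  translate (u, v) (rect x y a b) = rect (x + u) (y + v) a b.
Proof.
apply/seteqP; split=> [_ [[p q] [/= hp hq] <-]|[p q] [/= hp hq]].
  by split=> /=; lia.
exists (p - u, q - v); first by split=> /=; lia.
by congr pair; rewrite /= subrK.
Qed.

Lemma tileable_translate S v P : tileable S P -> tileable S (translate v P).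
Proof.
move=> [tau [tau_S tau_triv <-]].
exists [set t | exists2 s, tau s & t = translate v s]; split.
- move=> _ [t /tau_S [s [u [Ss ->]]] ->]; exists s, (u + v); split=> //.
  exact: translate_translate.
- move=> _ _ [t tau_t ->] [s tau_s ->] [_ [[c tc <-] [d sd /addIr edc]]].
  by congr translate; apply: tau_triv => //; exists c; split=> //; rewrite -edc.
- apply/seteqP; split=> [_ [_ [t tau_t ->] [c tc <-]]|_ [c [t tau_t tc] <-]].
    by exists c => //; exists t.
  by exists (translate v t); [exists t | exists c].
Qed.

(** The index [(p, q)] locates a 2 x n block, filled by an interlocked T3 and T4, in a grid of
    blocks. *)
Lemma stripes_placement (n A B : nat) : (4 <= n)%N ->
  placement n (2 * A)%N (n * B)%N (fun k x y => exists p q : int,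
    [/\ 0 <= p < B%:Z, 0 <= q < A%:Z, y = 2 * q
      & k = H3 /\ x = p * n%:Z \/ k = H4 /\ x = p * n%:Z + 1]).
Proof.
move=> n_ge4; split.
- move=> k x y cx cy [p [q [hp hq -> hk]]] ck.
  have : 0 <= p * n%:Z <= (B%:Z - 1) * n%:Z.
    apply/andP; split; first by apply: mulr_ge0; lia.
    by apply: ler_wpM2r; lia.
  rewrite mulrBl mul1r PoszM [_ * B%:Z]mulrC => hpn.
  by move: ck; case: hk => -[-> ->] /=; lia.
- move=> cx cy hx hy.
  have n0 : n%:Z != 0 by lia.
  have := divz_eq cx n; have := modz_ge0 cx n0.
  have := ltz_mod cx n0; set p := (cx %/ n)%Z; set r := (cx %% n)%Z.
  move=> r_lt r_ge0 ecx.
  have [q hq] := int_half cy.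
  have hp : 0 <= p < B%:Z.
    have pn1 : - n%:Z < p * n%:Z by lia.
    have pn2 : p * n%:Z < B%:Z * n%:Z by lia.
    have n_gt0 : 0 < n%:Z by lia.
    rewrite -(ltr_pM2r n_gt0) pn2 andbT.
    by have := ltr_pM2r n_gt0 (-1) p; rewrite mulN1r pn1; lia.
  have [h|h] : covers n H3 (p * n%:Z) (2 * q) cx cy \/
      covers n H4 (p * n%:Z + 1) (2 * q) cx cy by rewrite /=; lia.
    exists H3, (p * n%:Z), (2 * q); split=> //.
    by exists p, q; split; [lia|lia|lia|left].
  exists H4, (p * n%:Z + 1), (2 * q); split=> //.
  by exists p, q; split; [lia|lia|lia|right].
- move=> k x y k' x' y' cx cy [p [q [hp hq -> hk]]] [p' [q' [hp' hq' -> hk']]].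
  move=> ck ck'.
  have block l z (u : int) : l = H3 /\ z = u * n%:Z \/
      l = H4 /\ z = u * n%:Z + 1 -> forall v, covers n l z (2 * v) cx cy ->
      0 <= cx - u * n%:Z < n%:Z /\ 2 * v <= cy <= 2 * v + 1.
    by move=> [[-> ->]|[-> ->]] v /=; lia.
  have [hx hy] := block _ _ _ hk _ ck; have [hx' hy'] := block _ _ _ hk' _ ck'.
  have eq : q = q' by lia.
  have ep : p = p' by nia.
  subst p' q'; move: ck ck'.
  by case: hk hk' => -[-> ->] [] [-> ->] //=; lia.
Qed.

Lemma tileable_rect n a b x y : (4 <= n)%N -> ~~ odd a -> ~~ odd b ->
  (n %| a)%N \/ (n %| b)%N -> tileable (ribbon_L n) (rect x y a b).
Proof.
move=> n_ge4 ea eb dvd_n.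
have -> : rect x y a b = translate (x, y) (rect 0 0 a b).
  by rewrite translate_rect !add0r.
apply: tileable_translate; case: dvd_n => /dvdnP [B e].
  have -> : a = (n * B)%N by rewrite e mulnC.
  have -> : b = (2 * b./2)%N by lia.
  exact/placement_tileable/placement_transpose/stripes_placement.
have -> : b = (n * B)%N by rewrite e mulnC.
have -> : a = (2 * a./2)%N by lia.
exact/placement_tileable/stripes_placement.
Qed.

(** * The rectangular pattern *)

Lemma tiling_rectangular_pattern n a b tau : (4 <= n)%N -> ~~ odd n ->
  tiling (ribbon_L n) (rect 0 0 a b) tau ->
  rectangular_pattern n (rect 0 0 a b) tau.
Proof.
move=> n_ge4 n_even tau_til.
have n_ge4' : 4 <= n%:Z by lia.
have n_double : n%:Z = 2 * (n./2)%:Z by lia.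
have plT := tiling_placement n_ge4 tau_til.
have allp := placement_paired n_ge4' n_double plT.
have [T_sub _ T_disj] := plT.
set T := fun k x y => tau (tile n k x y) in plT allp T_sub T_disj.
have splitV i j : rect (2 * i) (2 * j) n 2 =
    tile n V1 (2 * i) (2 * j) `|` tile n V2 (2 * i) (2 * j + 1).
  apply/seteqP; split=> [c [h1 h2]|c [/tileP h|/tileP h]].
  - suff [h|h] : covers n V1 (2 * i) (2 * j) c.1 c.2 \/
        covers n V2 (2 * i) (2 * j + 1) c.1 c.2.
    + by left; apply/tileP.
    + by right; apply/tileP.
    by rewrite /=; lia.
  - by split; move: h => /=; lia.
  - by split; move: h => /=; lia.
have splitH i j : rect (2 * i) (2 * j) 2 n =
    tile n H3 (2 * i) (2 * j) `|` tile n H4 (2 * i + 1) (2 * j).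
  apply/seteqP; split=> [c [h1 h2]|c [/tileP h|/tileP h]].
  - suff [h|h] : covers n H3 (2 * i) (2 * j) c.1 c.2 \/
        covers n H4 (2 * i + 1) (2 * j) c.1 c.2.
    + by left; apply/tileP.
    + by right; apply/tileP.
    by rewrite /=; lia.
  - by split; move: h => /=; lia.
  - by split; move: h => /=; lia.
pose rho := [set R | exists i j : int,
  [/\ T V1 (2 * i) (2 * j), T V2 (2 * i) (2 * j + 1)
    & R = rect (2 * i) (2 * j) n 2] \/
  [/\ T H3 (2 * i) (2 * j), T H4 (2 * i + 1) (2 * j)
    & R = rect (2 * i) (2 * j) 2 n]].
(* A tile determines its rectangle, so disjointness of [rho] follows from that of the tiles. *)
have tileR R c : rho R -> R c -> exists k x y,
    [/\ T k x y, covers n k x y c.1 c.2 & R = match k with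
      | V1 => rect x y n 2 | V2 => rect x (y - 1) n 2
      | H3 => rect x y 2 n | H4 => rect (x - 1) y 2 n end].
  move=> [i [j [[t1 t2 ->]|[t1 t2 ->]]]].
    rewrite {1}splitV => -[/tileP h|/tileP h].
      by exists V1, (2 * i), (2 * j).
    by exists V2, (2 * i), (2 * j + 1); split=> //; rewrite addrK.
  rewrite {1}splitH => -[/tileP h|/tileP h].
    by exists H3, (2 * i), (2 * j).
  by exists H4, (2 * i + 1), (2 * j); split=> //; rewrite addrK.
exists rho; split.
- move=> R [i [j [[_ _ ->]|[_ _ ->]]]]; [right|left];
    by exists (2 * i), (2 * j); split=> //; split; lia.
- move=> R R' hR hR' [c [Rc R'c]].
  have [k [x [y [tk ck ->]]]] := tileR _ _ hR Rc.
  have [k' [x' [y' [tk' ck' ->]]]] := tileR _ _ hR' R'c.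
  by have [-> -> ->] := T_disj _ _ _ _ _ _ _ _ tk tk' ck ck'.
- apply/seteqP; split=> [c [R [i [j [[t1 t2 ->]|[t1 t2 ->]]]]]|c].
  + rewrite splitV => -[/tileP h|/tileP h]; apply/rect0P.
      exact: T_sub t1 h.
    exact: T_sub t2 h.
  + rewrite splitH => -[/tileP h|/tileP h]; apply/rect0P.
      exact: T_sub t1 h.
    exact: T_sub t2 h.
  + move=> /rect0P [hx hy].
    have [i [j [[t1 t2 h1 h2]|[t1 t2 h1 h2]]]] := allp _ _ hx hy.
      exists (rect (2 * i) (2 * j) n 2); last by split; lia.
      by exists i, j; left.
    exists (rect (2 * i) (2 * j) 2 n); last by split; lia.
    by exists i, j; right.
- move=> R [i [j [[t1 t2 ->]|[t1 t2 ->]]]].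
    exists (tile n V1 (2 * i) (2 * j)), (tile n V2 (2 * i) (2 * j + 1)).
    split=> // e; have : tile n V1 (2 * i) (2 * j) (2 * i, 2 * j).
      by apply/tileP => /=; lia.
    by rewrite e => /tileP /=; lia.
  exists (tile n H3 (2 * i) (2 * j)), (tile n H4 (2 * i + 1) (2 * j)).
  split=> // e; have : tile n H3 (2 * i) (2 * j) (2 * i, 2 * j).
    by apply/tileP => /=; lia.
  by rewrite e => /tileP /=; lia.
Qed.

(** * Divisibility by roots of unity *)

Lemma sum_geometric_nat (F : fieldType) (z : F) (n x N : nat) :
  z != 1 -> z ^+ n = 1 -> (x + n <= N)%N ->
  \sum_(i < N | (x <= i < x + n)%N) z ^+ i = 0.
Proof.
move=> z_neq1 zn1 le_N.
have -> : \sum_(i < N | (x <= i < x + n)%N) z ^+ i =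
    \sum_(x <= i < x + n) z ^+ i.
  rewrite -(big_mkord (fun i => x <= i < x + n)%N (fun i => z ^+ i)).
  rewrite [RHS](big_nat_widenl _ 0) // [RHS](big_nat_widen _ _ N) //.
rewrite -{1}[x]add0n big_addn addKn big_mkord.
have /eqP : (z - 1) * \sum_(i < n) z ^+ i = 0 by rewrite -subrX1 zn1 subrr.
rewrite mulf_eq0 subr_eq0 (negPf z_neq1) /= => /eqP sum0.
under eq_bigr do rewrite exprD.
by rewrite -mulr_suml sum0 mul0r.
Qed.

(** The weight of a bar is a product of sums over its sides, and the side [n] contributes a full
    period of powers of [z], which is 0. So the weight of the whole rectangle vanishes, and with it
    one of its two geometric sums. *)
Lemma rect_bars_dvdn (n a b : nat) (rho : set (set cell)) : (1 < n)%N ->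
  (forall R, rho R ->
     exists (x y : int) h, R = rect x y h n \/ R = rect x y n h) ->
  trivIset rho id -> \bigcup_(R in rho) R = rect 0 0 a b ->
  (n %| a)%N \/ (n %| b)%N.
Proof.
move=> n_gt1 bars triv cover.
have [z prim_z] := C_prim_root_exists (ltnW n_gt1).
have zn1 := prim_expr_order prim_z.
have z_neq1 : z != 1.
  by rewrite -(expr1 z) -(prim_order_dvd prim_z) dvdn1; lia.
(* [z - 1] times the sum is [z ^+ N - 1], and [z] has order exactly [n]. *)
have geo N : \sum_(i < N) z ^+ i = 0 -> (n %| N)%N.
  by rewrite (prim_order_dvd prim_z) -subr_eq0 subrX1 => ->; rewrite mulr0.
pose emb (c : 'I_b * 'I_a) : cell := (c.1%:Z, c.2%:Z).
(* The classes of [e] are the members of [rho], seen on the finite grid. *)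
pose e c d := `[< exists R, [/\ rho R, R (emb c) & R (emb d)] >].
have in_rho c : exists R, rho R /\ R (emb c).
  have : rect 0 0 a b (emb c).
    by apply/rect0P => /=; split; rewrite ltz_nat ltn_ord.
  by rewrite -cover => -[R rhoR Rc]; exists R.
have eE c R : rho R -> R (emb c) -> forall d, e c d <-> R (emb d).
  move=> rhoR Rc d; split=> [/asboolP [R' [rhoR' R'c R'd]]|Rd].
    by rewrite (triv R R') //; exists (emb c).
  by apply/asboolP; exists R.
have e_equiv : {in [set: 'I_b * 'I_a]%SET & &, equivalence_rel e}.
  move=> c d f _ _ _; have [R [rhoR Rc]] := in_rho c; split.
    by have [R' [rhoR' R'f]] := in_rho f; apply/(eE f R' rhoR' R'f).
  move=> /(eE c R rhoR Rc) Rd.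
  by apply/idP/idP=> [/(eE c R rhoR Rc)|/(eE d R rhoR Rd)] Rf;
    [apply/(eE d R rhoR Rd)|apply/(eE c R rhoR Rc)].
have := equivalence_partitionP e_equiv; set P := equivalence_partition _ _.
move=> partP.
have sum0 : \sum_(c in [set: 'I_b * 'I_a]%SET) z ^+ c.1 * z ^+ c.2 = 0.
  rewrite (set_partition_big _ partP) /=; apply: big1 => B /imsetP [c _ ->].
  have [R [rhoR Rc]] := in_rho c.
  have inR d : R d -> 0 <= d.1 < b%:Z /\ 0 <= d.2 < a%:Z.
    move=> Rd; suff /rect0P : rect 0 0 a b d by [].
    by rewrite -cover; exists R.
  have block p q (Q1 Q2 : pred nat) :
      (forall d, R (emb d) <-> Q1 d.1 && Q2 d.2) ->
      \sum_(i < b | Q1 i) z ^+ i = p -> \sum_(j < a | Q2 j) z ^+ j = q ->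
      \sum_(d in [set d in [set: 'I_b * 'I_a] | e c d]%SET) z ^+ d.1 * z ^+ d.2
      = p * q.
    move=> RE <- <-; rewrite big_distrlr /= pair_big /=; apply: eq_bigl => d.
    rewrite !inE /=; apply/idP/idP=> [/(eE c R rhoR Rc)/RE //|/RE Rd].
    exact/(eE c R rhoR Rc).
  have [x [y [h [eR|eR]]]] := bars R rhoR; move: Rc inR; rewrite {1 2}eR.
  - move=> [/= cx cy] inR.
    (* The two end cells of the bar in the row of [c] show that its long side stays within the range
       of summation. *)
    have [] := inR (x, c.2%:Z); first by split=> /=; lia.
    have [] := inR (x + n%:Z - 1, c.2%:Z); first by split=> /=; lia.
    move=> /= h1 _ h2 _.
    rewrite (block 0 _ (fun i => `|x| <= i < `|x| + n)%N
      (fun j => y <= j%:Z < y + h%:Z) _ _ erefl) ?mul0r //.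
      by move=> d; rewrite eR /rect /emb /=; lia.
    by apply: sum_geometric_nat => //; lia.
  - move=> [/= cx cy] inR.
    have [] := inR (c.1%:Z, y); first by split=> /=; lia.
    have [] := inR (c.1%:Z, y + n%:Z - 1); first by split=> /=; lia.
    move=> /= _ h1 _ h2.
    rewrite (block _ 0 (fun i => x <= i%:Z < x + h%:Z)
      (fun j => `|y| <= j < `|y| + n)%N _ erefl) ?mulr0 //.
      by move=> d; rewrite eR /rect /emb /=; lia.
    by apply: sum_geometric_nat => //; lia.
have /eqP : (\sum_(i < b) z ^+ i) * (\sum_(j < a) z ^+ j) = 0.
  rewrite big_distrlr /= pair_big /= -[RHS]sum0.
  by apply: eq_bigl => c; rewrite inE.
by rewrite mulf_eq0 => /orP [/eqP/geo|/eqP/geo]; [right|left].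
Qed.

Theorem theorem2 (n a b : nat) (n_ge4 : (4 <= n)%N) (n_even : ~~ odd n)
    (a_gt0 : (0 < a)%N) (b_gt0 : (0 < b)%N) :
  (forall x y : int,
     tileable (ribbon_L n) (rect x y a b) <->
     [/\ ~~ odd a, ~~ odd b & (n %| a)%N \/ (n %| b)%N]) /\
  (forall tau : set (set cell),
     tiling (ribbon_L n) (rect 0%R 0%R a b) tau ->
     rectangular_pattern n (rect 0%R 0%R a b) tau).
Proof.
split=> [x y|tau]; last exact: tiling_rectangular_pattern.
split=> [/(@tileable_translate _ (- x, - y))|[]]; last exact: tileable_rect.
rewrite translate_rect !subrr => -[tau tau_til].
have [rho [even_rho triv cover _]] :=
  tiling_rectangular_pattern n_ge4 n_even tau_til.
(* An even rectangle contains the even 2 x 2 square around each of its cells; at the top right cell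
   this forces [a] and [b] to be even. *)
have even_cell (cx cy : int) : rect 0 0 a b (cx, cy) -> exists i j : int,
    [/\ 2 * i <= cx <= 2 * i + 1, 2 * j <= cy <= 2 * j + 1
      & rect 0 0 a b (2 * i + 1, 2 * j + 1)].
  rewrite -cover => -[R rhoR Rc].
  have [i hi] := int_half cx; have [j hj] := int_half cy.
  exists i, j; split=> //; exists R => //.
  by case: (even_rho R rhoR) Rc => -[u [v [[h1 h2 h3 h4] ->]]] [/=] *;
    split=> /=; lia.
have [|i [j [hi hj /rect0P /= hij]]] := even_cell (b%:Z - 1) (a%:Z - 1).
  by split=> /=; lia.
split; [lia|lia|].
apply: (rect_bars_dvdn (rho := rho)) => //; first lia.
by move=> R /even_rho [] [u [v [_ ->]]]; exists u, v, 2%N; [left|right].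
Qed.
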